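(* Let $\mathbb{F}_q$ be a finite field, let $m,b\ge 1$ be integers, $n=mb$, and let $p(s)\in\mathbb{F}_q[s]$ be a primitive polynomial of degree $n$. The number of LFSRs over $\mathbb{F}_q$ with $m$-input $m$-output delay blocks whose transition matrices have $p(s)$ as their characteristic polynomial (equivalently, the number of $m$-companion matrices in $\mathbb{F}_q^{n\times n}$ with characteristic polynomial $p(s)$) is $$(q^n-q^{n-1})(q^n-q^{n-2})\cdots(q^n-q^{n-m+1})=\prod_{i=1}^{m-1}(q^n-q^{n-i})$$ (the empty product, equal to $1$, when $m=1$).
   Context: An LFSR (linear feedback shift register) over $\mathbb{F}_q$ with $m$-input $m$-output delay blocks, with $b$ delay blocks, is given by feedback matrices $B_0,\dots,B_{b-1}\in\mathbb{F}_q^{m\times m}$ and generates vectors $W(k)\in\mathbb{F}_q^m$ satisfying $W(k+b)=B_0W(k)+B_1W(k+1)+\cdots+B_{b-1}W(k+b-1)$. Its transition matrix is the $mb\times mb$ matrix $$A_{mb}=\begin{bmatrix} 0 & I & 0 & \cdots & 0 \\ 0 & 0 & I & \cdots & 0 \\ \vdots & \vdots & \vdots & \ddots & \vdots \\ 0 & 0 & 0 & \cdots & I \\ B_0 & B_1 & B_2 & \cdots & B_{b-1} \end{bmatrix}$$ with $m\times m$ blocks ($I$ the $m\times m$ identity; for $b=1$, $A_{mb}=B_0$). A matrix of this form is called an $m$-companion matrix. The transition matrix uniquely characterizes the LFSR, and the characteristic polynomial of the LFSR is that of its transition matrix. A primitive polynomial of degree $n$ over $\mathbb{F}_q$ is the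 minimal polynomial over $\mathbb{F}_q$ of a generator of $\mathbb{F}_{q^n}^*$. *)

(* Defs.v *)
From HB Require Import structures.
From mathcomp Require Import all_boot all_order all_algebra.
From mathcomp Require Import all_fingroup all_solvable all_field.
Set Implicit Arguments.
Unset Strict Implicit.
Unset Printing Implicit Defensive.
Import GRing.Theory.
Local Open Scope ring_scope.

(* The extension L of degree n over the finite field F is F_{q^n};
   [finvect_type L] is L with its finite field structure. *)
Definition is_primitive_poly (F : finFieldType) (n : nat) (p : {poly F}) : Prop :=
  exists (L : fieldExtType F) (u : {unit finvect_type L}),
    [/\ \dim {:L} = n,
        generator [set: {unit finvect_type L}] u
      & map_poly (in_alg L) p = minPoly 1%VS (FinRing.uval u : L)].

(* An LFSR with b delay blocks, given by its feedback matrices B_0..B_{b-1}: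
   it generates W(k+b) = B_0 W(k) + ... + B_{b-1} W(k+b-1). *)
Definition lfsr (F : finFieldType) (m b : nat) := {ffun 'I_b -> 'M[F]_m}.

(* For b = 1 the only block row is the last one, so the block is B_0. *)
Definition transition_block (F : finFieldType) (m b : nat) (B : lfsr F m b)
    (i j : 'I_b) : 'M[F]_m :=
  if i.+1 == b then B j
  else if j == i.+1 :> nat then 1%:M else 0.

Lemma sum_blocks (m b : nat) : (\sum_(i < b) m)%N = (m * b)%N.
Proof. by rewrite sum_nat_const card_ord mulnC. Qed.

Definition transition_mx (F : finFieldType) (m b : nat) (B : lfsr F m b) :
    'M[F]_(m * b) :=
  castmx (sum_blocks m b, sum_blocks m b)
    (\mxblock_(i < b, j < b) transition_block B i j).

Definition is_companion (F : finFieldType) (m b : nat) (A : 'M[F]_(m * b)) :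
    bool :=
  [exists B : lfsr F m b, A == transition_mx B].

(* Main.v *)
Require Import Defs.
From HB Require Import structures.
From mathcomp Require Import all_boot all_order all_algebra.
From mathcomp Require Import all_fingroup all_solvable all_field.
From mathcomp Require Import mxabelem.
Set Implicit Arguments.
Unset Strict Implicit.
Unset Printing Implicit Defensive.
Import GRing.Theory.
Local Open Scope ring_scope.

(* Let q = #|F|, K = F_{q^n} and let a be the root of p. A companion matrix with
   characteristic polynomial p has a one-dimensional a-eigenspace over K,
   spanned by a column (v, a v, ..., a^(b-1) v) whose n entries form an F-basis of K;
   conversely every such v arises from exactly one companion matrix. Hence
   (q^n - 1) times the wanted number is the number N of vectors v in K^m with
   w.v := \sum_ij w_ij a^j v_i nonzero for all nonzero w in F^(m x b).
   By inclusion-exclusion over sets S of nonzero w's, N = P(q^n) with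
   P(X) = \sum_S (-1)^#|S| X^(m - rk S), where rk S is the rank over K of the
   vectors (\sum_j w_ij a^j)_i for w in S. The minors are polynomials in a of
   degree at most m(b-1) = n-m, so rk S, hence P, is the same for every finite
   extension of F generated by an element of degree > n-m. Over F_{q^(n-i)} with
   0 < i < m no v qualifies, since F^(m x b) does not embed into a smaller space:
   so P(q^(n-i)) = 0. Also P(1) = 0, and P is monic of degree m, whence
   P(X) = (X - 1) \prod_(0 < i < m) (X - q^(n-i)). *)

(** * Vectors avoiding a family of hyperplanes *)

Lemma size_det_leq (R : comNzRingType) (b n : nat) (M : 'M[{poly R}]_n) :
  (forall i j, (size (M i j) <= b.+1)%N) -> (size (\det M) <= (n * b).+1)%N.
Proof.
move=> sM; rewrite /determinant; apply: (leq_trans (size_sum _ _ _)).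
apply/bigmax_leqP=> s _; rewrite mulr_sign.
have H : (size (\prod_i M i (s i))%R <= (n * b).+1)%N.
  apply: (leq_trans (size_prod_leq _ _)); rewrite card_ord.
  have : (\sum_(i < n) size (M i (s i)) <= \sum_(i < n) b.+1)%N.
    by apply: leq_sum => i _.
  rewrite sum_nat_const card_ord mulnS => h.
  by rewrite leq_subLR addnS ltnS.
by case: ifP => _; rewrite ?size_polyN.
Qed.

(* A nonzero maximal minor over [K] comes from a nonzero polynomial of degree at
   most [m * b], which survives in [K']. *)
Lemma rank_map_mx_leq (R : comNzRingType) (K K' : fieldType)
    (e : {rmorphism {poly R} -> K}) (e' : {rmorphism {poly R} -> K'})
    (m n b : nat) (M : 'M[{poly R}]_(m, n)) :
  (forall i j, size (M i j) <= b.+1)%N ->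
  (forall g : {poly R}, g != 0 -> (size g <= (m * b).+1)%N -> e' g != 0) ->
  (\rank (map_mx e M) <= \rank (map_mx e' M))%N.
Proof.
move=> sM e'N0; set A := map_mx e M.
set r := \rank A.
(* Choosing [r] independent rows of [A], then [r] independent columns of those, gives an invertible
   square submatrix; [M0] lifts its transpose to polynomials. *)
have fullA : row_full (rowsub (maxrankfun A) A)^T.
  by rewrite /row_full mxrank_tr; apply: maxrowsub_free.
have := fullrowsub_unit fullA.
set f := maxrankfun A; set h := fullrankfun fullA.
rewrite unitmxE unitfE => detN0.
set M0 : 'M[{poly R}]_r := rowsub h (rowsub f M)^T.
have detM0 : e (\det M0) != 0.
  rewrite -det_map_mx /M0; congr (\det _ != 0): detN0.
  by apply/matrixP=> i j; rewrite !mxE.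
have M0N0 : \det M0 != 0 by apply: contraNneq detM0 => ->; rewrite rmorph0.
have ler : (r <= m)%N by apply: rank_leq_row.
have : e' (\det M0) != 0.
  apply: e'N0 => //; apply: leq_trans (_ : (r * b).+1 <= _)%N.
    by apply: size_det_leq => i j; rewrite !mxE.
  by rewrite ltnS leq_mul2r ler orbT.
rewrite -det_map_mx -unitfE -unitmxE -row_free_unit => /eqP rk.
have -> : r = \rank (map_mx e' M0) by rewrite rk.
have -> : map_mx e' M0 = rowsub h (rowsub f (map_mx e' M))^T.
  by apply/matrixP=> i j; rewrite !mxE.
apply: leq_trans (_ : \rank (rowsub f (map_mx e' M))^T <= _)%N.
  by rewrite rowsubE mxrankM_maxr.
by rewrite mxrank_tr rowsubE mxrankM_maxr.
Qed.

Section AvoidingVectors.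

Variables (F : finFieldType) (m b : nat) (T : finType).
Variable g : T -> 'I_m -> {poly F}.

(** Columns outside [S] are zeroed rather than removed, so the matrix format does not depend on
    [S]. *)
Definition subfamily_mx (S : {set T}) : 'M[{poly F}]_(m, #|T|) :=
  \matrix_(i, j) if enum_val j \in S then g (enum_val j) i else 0.

Definition avoiding (K : finFieldType) (e : {rmorphism {poly F} -> K}) :=
  [set v : 'rV[K]_m | [forall t, \sum_i v 0 i * e (g t i) != 0]].

(** The exponent is the dimension over [K] of the space of [v] orthogonal to every member of [S]. *)
Definition avoiding_poly (K : finFieldType) (e : {rmorphism {poly F} -> K}) :
  {poly rat} :=
  \sum_(S : {set T}) (-1) ^+ #|S| *: 'X^(m - \rank (map_mx e (subfamily_mx S))).

Lemma annihilatorE (K : finFieldType) (e : {rmorphism {poly F} -> K}) S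
    (v : 'rV[K]_m) :
  (v *m map_mx e (subfamily_mx S) == 0)
    = [forall (t | t \in S), \sum_i v 0 i * e (g t i) == 0].
Proof.
apply/eqP/forall_inP => [H t tS | H].
  have /rowP/(_ (enum_rank t)) := H; rewrite !mxE => H'.
  apply/eqP; rewrite -[RHS]H'; apply: eq_bigr => i _.
  by rewrite !mxE enum_rankK tS.
apply/rowP=> j; rewrite !mxE.
case: (boolP (enum_val j \in S)) => jS.
  by have /eqP {2}<- := H _ jS; apply: eq_bigr => i _; rewrite !mxE jS.
by rewrite big1 // => i _; rewrite !mxE (negbTE jS) rmorph0 mulr0.
Qed.

(** The indicator of [avoiding] is the product of the [1 - z v t]; expanding it over subsets [S]
    leaves, for each [S], the size of a left kernel. *)
Lemma card_avoiding (K : finFieldType) (e : {rmorphism {poly F} -> K}) :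
  #|avoiding e|%:R = (avoiding_poly e).[#|K|%:R].
Proof.
pose z (v : 'rV[K]_m) t : rat := (\sum_i v 0 i * e (g t i) == 0)%:R.
have -> : #|avoiding e|%:R = \sum_(v : 'rV[K]_m) \prod_t (- z v t + 1) :> rat.
  rewrite -sum1_card natr_sum big_mkcond /=; apply: eq_bigr => v _.
  rewrite inE /z; case: forallP => [H | /forallP].
    by rewrite big1 // => t _; rewrite (negbTE (H t)) oppr0 add0r.
  rewrite negb_forall => /existsP[t]; rewrite negbK => Ht.
  by rewrite (bigD1 t) //= Ht addNr mul0r.
under eq_bigr do rewrite bigA_distr.
rewrite exchange_big /= /avoiding_poly horner_sum; apply: eq_bigr => S _.
rewrite hornerZ hornerXn -natrX -mxrank_ker -card_rowg.
transitivity (\sum_(v : 'rV[K]_m)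
    (-1) ^+ #|S| * (v *m map_mx e (subfamily_mx S) == 0)%:R : rat).
  apply: eq_bigr => v _; rewrite annihilatorE -big_mkcond /= prodrN.
  congr (_ * _); rewrite /z; case: forall_inP => [H | /forall_inP].
    by rewrite big1 // => t /H ->.
  rewrite negb_forall_in => /exists_inP[t tS Ht].
  by rewrite (bigD1 t) //= (negbTE Ht) mul0r.
rewrite -mulr_sumr; congr (_ * _).
rewrite -natr_sum; congr (_%:R).
rewrite -sum1_card [RHS]big_mkcond /=; apply: eq_bigr => v _.
by rewrite mem_rowg sub_kermx; case: eqP.
Qed.

Hypothesis sg : forall t i, (size (g t i) <= b.+1)%N.

Lemma avoiding_poly_indep (K K' : finFieldType) (e : {rmorphism {poly F} -> K})
    (e' : {rmorphism {poly F} -> K'}) :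
  (forall p : {poly F}, p != 0 -> (size p <= (m * b).+1)%N -> e p != 0) ->
  (forall p : {poly F}, p != 0 -> (size p <= (m * b).+1)%N -> e' p != 0) ->
  avoiding_poly e = avoiding_poly e'.
Proof.
move=> eN0 e'N0; apply: eq_bigr => S _; congr (_ *: 'X^(m - _)).
have sS i j : (size (subfamily_mx S i j) <= b.+1)%N.
  by rewrite mxE; case: ifP; rewrite ?size_poly0.
by apply/eqP; rewrite eqn_leq !(@rank_map_mx_leq _ _ _ _ _ _ _ b).
Qed.

(** Only [set0] has rank 0, contributing ['X^m]; any other [S] has a nonzero column, hence a term of
    smaller degree. *)
Lemma avoiding_poly_monic (K : finFieldType) (e : {rmorphism {poly F} -> K}) :
    (forall t, exists i, e (g t i) != 0) ->
  avoiding_poly e \is monic /\ size (avoiding_poly e) = m.+1.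
Proof.
move=> gN0; rewrite /avoiding_poly (bigD1 set0) //= cards0 scale1r.
have -> : \rank (map_mx e (subfamily_mx set0)) = 0%N.
  have -> : subfamily_mx set0 = 0 by apply/matrixP=> i j; rewrite !mxE inE.
  by rewrite map_mx0 mxrank0.
rewrite subn0; set Q := \sum_(_ | _) _.
have sQ : (size Q < size ('X^m : {poly rat}))%N.
  rewrite size_polyXn ltnS; apply: (leq_trans (size_sum _ _ _)).
  apply/bigmax_leqP=> S /set0Pn[t tS]; have [i eti] := gN0 t.
  have rk : (0 < \rank (map_mx e (subfamily_mx S)))%N.
    rewrite lt0n mxrank_eq0; apply: contra_neq eti => /matrixP/(_ i (enum_rank t)).
    by rewrite !mxE enum_rankK tS.
  apply: (leq_trans (size_scale_leq _ _)); rewrite size_polyXn.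
  by rewrite ltn_subrL rk (leq_ltn_trans _ (ltn_ord i)).
by rewrite monicE lead_coefDl // lead_coefXn size_polyDl // size_polyXn.
Qed.

(** At 1 the sum is the expansion of $(1-1)^{|T|}$, which vanishes because [t0] inhabits [T]. *)
Lemma avoiding_poly_root1 (K : finFieldType) (e : {rmorphism {poly F} -> K})
    (t0 : T) :
  root (avoiding_poly e) 1.
Proof.
rewrite /root /avoiding_poly horner_sum.
under eq_bigr do rewrite hornerZ hornerXn expr1n mulr1.
have : \prod_(t : T) (-1 + 1)
    = \sum_(S : {set T}) \prod_t (if t \in S then -1 else 1) :> rat.
  by rewrite bigA_distr.
rewrite (bigD1 t0) //= addNr mul0r => /esym /eqP; congr (_ == _).
by apply: eq_bigr => S _; rewrite -big_mkcond prodr_const.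
Qed.

End AvoidingVectors.

(** * Finite extensions as evaluations of polynomials *)

Lemma separable_Xn_sub_X (R : idomainType) (n : nat) :
  n%:R = 0 :> R -> separable_poly ('X^n - 'X : {poly R}).
Proof.
move=> n0; rewrite unlock derivB derivXn derivX -mulr_natr -polyC_natr n0.
rewrite polyC0 mulr0 sub0r coprimep_sym -scaleN1r.
by rewrite coprimepZl ?oppr_eq0 ?oner_eq0 ?coprime1p.
Qed.

Lemma card_finvect (F : finFieldType) (L : fieldExtType F) :
  #|finvect_type L| = (#|F| ^ \dim {:L})%N.
Proof.
by rewrite -(card_vspacef (Vector.class (finvect_type L))) card_vspace.
Qed.

(** The field is the splitting field of ['X^N - 'X] with $N = q^k$: the [N] roots are distinct and
    form a subfield, so they are the whole field. *)
Lemma finFieldExt_exists (F : finFieldType) (k : nat) :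
  (0 < k)%N -> exists L : fieldExtType F, \dim {:L} = k.
Proof.
move=> k_gt0; set N := (#|F| ^ k)%N.
have N_gt1 : (1 < N)%N by rewrite -(exp1n k) ltn_exp2r // finNzRing_gt1.
have sQ (R : nzRingType) : size ('X^N - 'X : {poly R}) = N.+1.
  by rewrite size_polyDl size_polyXn // size_polyN size_polyX.
have nzQ : 'X^N - 'X != 0 :> {poly F} by rewrite -size_poly_eq0 sQ.
have [/= L [zs DqL defL]] := FinSplittingFieldFor nzQ.
rewrite rmorphB /= map_polyXn map_polyX in DqL.
exists L.
have [p pr_p pcharFp] := finPcharP F.
have N0 : N%:R = 0 :> L.
  have [c cF] : exists c, #|F| = (p ^ c)%N.
    by exists (logn p #|F|); apply: (card_pprimeChar pcharFp).
  have c_gt0 : (0 < c)%N by case: c cF (finNzRing_gt1 F) => // ->; rewrite expn0.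
  rewrite /N cF -expnM natrX pcharf0 ?pchar_lalg //.
  by rewrite expr0n muln_eq0 !eqn0Ngt c_gt0 k_gt0.
have Uzs : uniq zs.
  by rewrite -separable_prod_XsubC -(eqp_separable DqL) separable_Xn_sub_X.
have szs : size zs = N.
  by apply: succn_inj; rewrite -(size_prod_XsubC _ id) -(eqp_size DqL) sQ.
have zsP z : (z \in zs) = (z ^+ N == z).
  by rewrite -root_prod_XsubC -(eqp_root DqL) /root !hornerE subr_eq0.
(* [a] is the Frobenius map $x \mapsto x^q$, so the roots are exactly the fixed points of
   [a ^+ k]. *)
have [/= a _ Da] := finField_galois_generator (sub1v {:L}).
rewrite dimv1 expn1 in Da.
pose Em := fixedSpace (a ^+ k)%g.
have in_zs : zs =i Em.
  move=> z; rewrite zsP (sameP fixedSpaceP eqP) /N; congr (_ == z).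
  elim: (k) => [|i IHi]; first by rewrite gal_id.
  by rewrite expgSr expnSr exprM IHi galM ?Da ?memvf.
have defEm : Em = {:L}%VS.
  apply/eqP; rewrite eqEsubv subvf -defL -[Em]subfield_closed agenvS //.
  by rewrite subv_add sub1v; apply/span_subvP=> z; rewrite in_zs.
have oN : #|finvect_type L| = N.
  rewrite -szs -(elimT (@card_uniqP (finvect_type L) zs) Uzs).
  apply: eq_card => z.
  by rewrite in_zs defEm memvf.
by apply/eqP; rewrite -(eqn_exp2l _ _ (finNzRing_gt1 F)) -card_finvect oN.
Qed.

Lemma adjoin_degree1 (F : fieldType) (L : fieldExtType F) (a : L) :
  adjoin_degree 1%AS a = \dim <<1%AS; a>>%VS.
Proof. by rewrite dim_Fadjoin dimv1 muln1. Qed.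

(** Every nonzero element of [L] is a power of [u], so the minimal polynomial of [u] has degree
    [\dim {:L}], more than the degree of [g]. *)
Lemma generator_horner_neq0 (F : finFieldType) (L : fieldExtType F)
    (u : {unit finvect_type L}) (g : {poly F}) :
  generator [set: {unit finvect_type L}] u ->
  g != 0 -> (size g <= \dim {:L})%N ->
  horner_alg (FinRing.uval u) g != 0.
Proof.
set a : L := FinRing.uval u.
move=> /eqP gen gN0 sg; apply/negP => /eqP g0.
have ga : root (map_poly (in_alg L) g) a by apply/eqP.
have gO : map_poly (in_alg L) g \is a polyOver 1%VS.
  by apply/polyOver1P; exists g.
have gN0' : map_poly (in_alg L) g != 0 by rewrite map_poly_eq0.
have := dvdp_leq gN0' (minPoly_dvdp gO ga).
rewrite size_minPoly size_map_poly.
rewrite adjoin_degree1.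
suff -> : <<1%AS; a>>%VS = {:L}%VS by move=> /leq_trans/(_ sg); rewrite ltnn.
apply/vspaceP=> x; rewrite memvf.
have [->|xN0] := eqVneq x 0; first exact: mem0v.
pose ux := finField_unit (xN0 : (x : finvect_type L) != 0).
have : ux \in <[u]>%g by rewrite -gen inE.
case/cycleP=> i Hi.
have -> : x = a ^+ i :> L.
  by have := congr1 val Hi; rewrite FinRing.val_unitX.
by rewrite rpredX // memv_adjoin.
Qed.

(** Taken at [k = n - i], this supplies the smaller fields over which no vector qualifies. *)
Lemma finField_evaluation_exists (F : finFieldType) (k : nat) : (0 < k)%N ->
  exists (K : finFieldType) (e : {rmorphism {poly F} -> K}),
    #|K| = (#|F| ^ k)%N /\
    forall g : {poly F}, g != 0 -> (size g <= k)%N -> e g != 0.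
Proof.
move=> /(finFieldExt_exists F)[L dimL].
have /cyclicP[u Hu] := field_unit_group_cyclic [set: {unit finvect_type L}]%G.
exists (finvect_type L), (horner_alg (FinRing.uval u)).
rewrite card_finvect dimL; split=> // g gN0 sg.
by apply: generator_horner_neq0; rewrite ?dimL //; apply/eqP.
Qed.

(** * Eigenvectors and F-linear independence *)

Lemma mulmx_castmx_sq (R : pzSemiRingType) (p n n' : nat) (en : n = n')
    (A : 'M[R]_n) (x : 'M[R]_(n, p)) :
  castmx (en, en) A *m castmx (en, erefl) x = castmx (en, erefl) (A *m x).
Proof. by case: n' / en. Qed.

Lemma mulmx_castmx_mid (R : pzSemiRingType) (p q n n' : nat) (en : n = n')
    (w : 'M[R]_(p, n)) (x : 'M[R]_(n, q)) :
  castmx (erefl, en) w *m castmx (en, erefl) x = w *m x.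
Proof. by case: n' / en. Qed.

Lemma map_mxblock (R S : Type) (f : R -> S) (p q : nat) (p_ : 'I_p -> nat)
    (q_ : 'I_q -> nat) (B : forall i j, 'M[R]_(p_ i, q_ j)) :
  map_mx f (\mxblock_(i, j) B i j) = \mxblock_(i, j) map_mx f (B i j).
Proof. by apply/matrixP=> i j; rewrite !mxE. Qed.

Lemma char_poly_tr (R : comNzRingType) (n : nat) (A : 'M[R]_n) :
  char_poly A^T = char_poly A.
Proof.
rewrite /char_poly -[RHS]det_tr; congr (\det _).
by apply/matrixP=> i j; rewrite !mxE eq_sym.
Qed.

Section Evaluation.

Variables (F K : fieldType) (e : {rmorphism {poly F} -> K}).
Local Notation iota := (e \o polyC).

Lemma evaluationE (g : {poly F}) : e g = (map_poly iota g).[e 'X].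
Proof.
rewrite -[g in LHS]coefK poly_def rmorph_sum /=.
rewrite /map_poly poly_def horner_sum /=; apply: eq_bigr => i _.
by rewrite hornerZ hornerXn -mul_polyC rmorphM rmorphXn.
Qed.

Lemma evaluation_rVpoly (n : nat) (u : 'rV[F]_n) :
  e (rVpoly u) = \sum_k iota (u 0 k) * e 'X ^+ k.
Proof.
rewrite {1}[u]row_sum_delta !linear_sum rmorph_sum /=; apply: eq_bigr => k _.
by rewrite linearZ /= rVpoly_delta -mul_polyC rmorphM rmorphXn.
Qed.

Variable n : nat.
Hypothesis eN0 : forall g : {poly F}, g != 0 -> (size g <= n)%N -> e g != 0.

(** Both polynomials vanish under [e]; being monic of degree [n], they differ by a polynomial of
    size at most [n], which [eN0] forces to be 0. *)
Lemma char_poly_eigenvector (A : 'M[F]_n) (p : {poly F}) (x : 'cV[K]_n) :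
  p \is monic -> size p = n.+1 -> e p = 0 -> x != 0 ->
  map_mx iota A *m x = e 'X *: x -> char_poly A = p.
Proof.
move=> p_monic sp ep x0 Ax.
have chi0 : e (char_poly A) = 0.
  (* [eigenvalue] concerns row vectors, hence the transposes. *)
  rewrite -char_poly_tr evaluationE map_char_poly.
  apply/eqP; rewrite -/(root _ _).
  rewrite -eigenvalue_root_char; apply/eigenvalueP.
  exists x^T; last by rewrite trmx_eq0.
  by rewrite -map_trmx -trmx_mul Ax linearZ.
apply/eqP; rewrite -subr_eq0; apply/negPn/negP => d0.
have /eqP[] : e (char_poly A - p) != 0; last by rewrite rmorphB /= chi0 ep subrr.
apply: eN0 d0 _; apply/leq_sizeP => j; rewrite leq_eqVlt coefB => /orP[/eqP<-|nj].
  have /eqP := char_poly_monic A; rewrite lead_coefE size_char_poly => ->.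
  by move/eqP: p_monic; rewrite lead_coefE sp => ->; rewrite subrr.
by rewrite !nth_default ?subrr ?sp ?size_char_poly.
Qed.

(* [e g = 0] forces [size g > n], so the characteristic polynomial, which
   vanishes under [e], is coprime to every nonzero [g] with [size g <= n]. *)
Lemma eigenvector_free (A : 'M[F]_n) (x : 'cV[K]_n) (w : 'rV[F]_n) :
  e (char_poly A) = 0 -> x != 0 ->
  map_mx iota A *m x = e 'X *: x -> map_mx iota w *m x = 0 -> w = 0.
Proof.
case: n eN0 A x w => [|n'] e0 A x w chi0 x0 Ax wx; first exact: thinmx0.
apply/eqP/negPn/negP => w0.
have coprime_chi (g : {poly F}) :
    g != 0 -> (size g <= n'.+1)%N -> coprimep (char_poly A) g.
  move=> g0 sg; set d := gcdp (char_poly A) g.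
  have chi_neq0 : char_poly A != 0 by rewrite monic_neq0 ?char_poly_monic.
  have d0 : d != 0 by rewrite gcdp_eq0 negb_and g0 orbT.
  have ed0 : e d != 0.
    by apply: e0 => //; rewrite (leq_trans (dvdp_leq g0 (dvdp_gcdr _ _))).
  have /dvdpP[h chiE] : d %| char_poly A by apply: dvdp_gcdl.
  have h0 : h != 0 by apply: contraNneq chi_neq0 => h0; rewrite chiE h0 mul0r.
  have eh : e h = 0.
    by apply/eqP; move/eqP: chi0; rewrite chiE rmorphM mulf_eq0 (negbTE ed0) orbF.
  have sh : (n'.+1 < size h)%N.
    by rewrite ltnNge; apply: contraL (e0 h h0) _; rewrite eh eqxx.
  have sd : (size h + size d).-1 = n'.+2.
    by rewrite -(size_char_poly A) chiE size_mul.
  have sd_gt0 : (0 < size d)%N by rewrite size_poly_gt0.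
  have sz : (size h + size d = n'.+3)%N.
    by rewrite -sd prednK // addn_gt0 sd_gt0 orbT.
  rewrite coprimep_def -/d eqn_leq; apply/andP; split=> //.
  by rewrite -(leq_add2l n'.+2) addn1 -sz leq_add2r.
(* A relation [u] between the rows $wA^i$ says that $g(A)$ kills [w], with [g = rVpoly u]; Bezout
   and Cayley-Hamilton then give [w = 0] unless [u = 0]. *)
pose U := \matrix_(i < n'.+1) (w *m horner_mx A 'X^i).
have UE (u : 'rV_n'.+1) : u *m U = w *m horner_mx A (rVpoly u).
  rewrite mulmx_sum_row {2}[u]row_sum_delta !linear_sum.
  by apply: eq_bigr => i _; rewrite rowK !linearZ /= rVpoly_delta.
have freeU : row_free U.
  rewrite -kermx_eq0; apply/rowV0P => u; rewrite sub_kermx UE => /eqP wu.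
  apply/eqP; apply: contraNT w0 => u0.
  have g0 : rVpoly u != 0.
    by apply: contraNneq u0 => g0; rewrite -[u]rVpolyK g0 linear0.
  have /Bezout_eq1_coprimepP[[a c] /= Hac] := coprime_chi _ g0 (size_poly _ _).
  rewrite -[w]mulmx1 idmxE -(rmorph1 (horner_mx A)) -Hac.
  rewrite [_ * rVpoly u]mulrC rmorphD !rmorphM /=.
  by rewrite Cayley_Hamilton mulr0 add0r -mulmxE mulmxA wu mul0mx.
(* Since $A^i x = \alpha^i x$ with $\alpha$ the image of ['X], every row of [U] kills [x], although
   [U] is invertible and [x] nonzero. *)
have Ux : map_mx iota U *m x = 0.
  apply/row_matrixP=> i; rewrite row_mul row0 -map_row rowK map_mxM -mulmxA.
  suff -> : map_mx iota (horner_mx A 'X^i) *m x = e 'X ^+ i *: x.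
    by rewrite -scalemxAr wx scaler0.
  elim: (i : nat) => [|k IHk]; first by rewrite rmorph1 map_mx1 mul1mx scale1r.
  rewrite exprSr rmorphM /= horner_mx_X -mulmxE map_mxM -mulmxA Ax -scalemxAr.
  by rewrite IHk scalerA exprS.
move: freeU; rewrite row_free_unit -(map_unitmx iota) => uU.
by move: x0; rewrite -[x](mulKmx uU) Ux mulmx0 eqxx.
Qed.
End Evaluation.

(** * Block companion matrices *)

Lemma castmx_row_inj (R : Type) (p n n' : nat) (en : n = n') :
  injective (castmx (en, erefl p) : 'M[R]_(n, p) -> 'M[R]_(n', p)).
Proof. by case: n' / en. Qed.

Lemma scale_castmx (R : pzRingType) (p n n' : nat) (en : n = n') a
    (x : 'M[R]_(n, p)) :
  a *: castmx (en, erefl) x = castmx (en, erefl) (a *: x).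
Proof. by case: n' / en. Qed.

Section Companion.

Variables (F K : finFieldType) (e : {rmorphism {poly F} -> K}) (m b : nat).
Local Notation iota := (e \o polyC).
Local Notation alpha := (e 'X).
Local Notation n := (m * b.+1)%N.
Implicit Types (B : lfsr F m b.+1) (v : 'rV[K]_m).

Definition block_state (y : 'I_b.+1 -> 'cV[K]_m) : 'cV[K]_n :=
  castmx (sum_blocks m b.+1, erefl) (\mxcol_k y k).

Definition delay_state v := block_state (fun k => alpha ^+ k *: v^T).

(* This is [\sum_(i, j) w i j * alpha ^+ j * v 0 i]. *)
Definition span_map v (w : 'M[F]_(m, b.+1)) : K :=
  \sum_i v 0 i * e (rVpoly (row i w)).

(** The last block row of the eigenvector equation for [delay_state v]; the other block rows hold
    for every [v]. *)
Definition generates B v : bool :=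
  [forall i, span_map v (\matrix_(k, j) B j i k) == alpha ^+ b.+1 * v 0 i].

Lemma block_state_eigen B y :
  map_mx iota (transition_mx B) *m block_state y = alpha *: block_state y <->
  (forall i, \sum_j map_mx iota (transition_block B i j) *m y j = alpha *: y i).
Proof.
rewrite /block_state scale_castmx map_castmx mulmx_castmx_sq map_mxblock.
rewrite mul_mxblock_mxrow.
have -> : alpha *: \mxcol_k y k = \mxcol_k (alpha *: y k).
  by apply/matrixP=> i j; rewrite !mxE.
split=> [/castmx_row_inj/eq_mxcolP// | H].
by congr castmx; apply/eq_mxcolP.
Qed.

Lemma block_stateK (x : 'cV[K]_n) : exists y, x = block_state y.
Proof.
exists (submxcol (castmx (esym (sum_blocks m b.+1), erefl) x)).
by rewrite /block_state submxcolK castmx_comp castmx_id.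
Qed.

Lemma eigen_rowE (y : 'I_b.+1 -> 'cV[K]_m) B (i : 'I_b.+1) (ib : (i.+1 < b.+1)%N) :
  \sum_j map_mx iota (transition_block B i j) *m y j = y (Ordinal ib).
Proof.
rewrite (bigD1 (Ordinal ib)) //= /transition_block ltn_eqF // eqxx map_mx1 mul1mx.
rewrite big1 ?addr0 // => j; rewrite -val_eqE /= => /negbTE ->.
by rewrite map_mx0 mul0mx.
Qed.

Lemma generatesE B v (i : 'I_m) :
  span_map v (\matrix_(k, j) B j i k)
    = (\sum_j map_mx iota (B j) *m (alpha ^+ j *: v^T)) i 0.
Proof.
rewrite /span_map summxE.
under eq_bigr do rewrite evaluation_rVpoly mulr_sumr.
rewrite exchange_big /=; apply: eq_bigr => j _; rewrite mxE; apply: eq_bigr => k _.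
by rewrite !mxE [RHS]mulrA [RHS]mulrC.
Qed.

Lemma generatesP B v :
  map_mx iota (transition_mx B) *m delay_state v = alpha *: delay_state v <->
  generates B v.
Proof.
rewrite /delay_state; split.
  move/block_state_eigen => /(_ ord_max) /matrixP H.
  apply/forallP=> i; rewrite generatesE; move: (H i 0).
  rewrite !mxE mulrA -exprS => <-; apply/eqP; congr (fun_of_matrix _ i 0).
  by apply: eq_bigr => j _; rewrite /transition_block eqxx.
move=> /forallP H; apply/block_state_eigen => i.
have [ib|] := ltnP i.+1 b.+1.
  by rewrite eigen_rowE /= scalerA exprS.
move=> bi; have -> : i = ord_max.
  by apply/val_inj/eqP; rewrite /= eqn_leq -ltnS ltn_ord -ltnS.
apply/matrixP=> k l; rewrite ord1 {l} [RHS]mxE [X in _ * X]mxE mulrA -exprS.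
move/eqP: (H k); rewrite generatesE mxE => <-.
congr (fun_of_matrix _ k 0).
by apply: eq_bigr => j _; rewrite /transition_block eqxx.
Qed.

(** The shift rows force each block to be [alpha] times the previous one, so block 0 determines the
    vector. *)
Lemma eigenvector_delay_state B (x : 'cV[K]_n) :
  map_mx iota (transition_mx B) *m x = alpha *: x ->
  exists v, x = delay_state v.
Proof.
have [y ->] := block_stateK x => /block_state_eigen H.
exists (y ord0)^T; rewrite /delay_state; congr (castmx _ _); apply/eq_mxcolP => k.
rewrite trmxK; case: k; elim=> [|k IHk] lt_k.
  by rewrite expr0 scale1r; congr y; apply: val_inj.
have := H (Ordinal (ltnW lt_k)); rewrite IHk scalerA -exprS => <-.
by rewrite (eigen_rowE y B (lt_k : (Ordinal (ltnW lt_k)).+1 < _)%N).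
Qed.

(** This puts [span_map v w] in the form to which [eigenvector_free] applies. *)
Lemma mul_delay_state v (w : 'M[F]_(m, b.+1)) :
  map_mx iota (castmx (erefl, sum_blocks m b.+1) (\mxrow_k (col k w)^T))
      *m delay_state v
    = (span_map v w)%:M.
Proof.
rewrite map_castmx mulmx_castmx_mid.
have -> : map_mx iota (\mxrow_k (col k w)^T) = \mxrow_k map_mx iota (col k w)^T.
  by apply/matrixP=> i j; rewrite !mxE.
rewrite mul_mxrow_mxcol; apply/matrixP=> i j; rewrite !ord1 {i j} summxE.
rewrite [RHS]mxE eqxx mulr1n /span_map.
under [RHS]eq_bigr do rewrite evaluation_rVpoly mulr_sumr.
rewrite exchange_big /=; apply: eq_bigr => k _; rewrite mxE; apply: eq_bigr => i _.
by rewrite !mxE mulrA mulrC.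
Qed.


(** Indices of the hyperplanes to avoid; with [row_poly], the linear form attached to [w] is
    [span_map _ w]. *)
Definition nonzero_mx := {w : 'M[F]_(m, b.+1) | w != 0}.
Definition row_poly (t : nonzero_mx) (i : 'I_m) : {poly F} :=
  rVpoly (row i (val t)).

Lemma avoidingP v :
  reflect (forall w, span_map v w = 0 -> w = 0) (v \in avoiding row_poly e).
Proof.
rewrite inE; apply: (iffP forallP) => [H w vw | H t].
  by apply/eqP/negPn/negP => w0; have /negP[] := H (exist _ w w0); apply/eqP.
by apply/eqP => /H /eqP; rewrite (negbTE (valP t)).
Qed.

Lemma span_map_is_additive v : zmod_morphism (span_map v).
Proof.
move=> w w'; rewrite /span_map -sumrB; apply: eq_bigr => i _.
by rewrite !linearB /= rmorphB mulrBr.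
Qed.

Lemma span_mapZ c v w : span_map (c *: v) w = c * span_map v w.
Proof. by rewrite /span_map mulr_sumr; apply: eq_bigr => i _; rewrite mxE mulrA. Qed.

Lemma span_mapB v v' w : span_map (v - v') w = span_map v w - span_map v' w.
Proof. by rewrite /span_map -sumrB; apply: eq_bigr => i _; rewrite !mxE mulrBl. Qed.

Lemma generatesZ B c v : generates B v -> generates B (c *: v).
Proof.
move=> /forallP H; apply/forallP=> i.
by rewrite span_mapZ (eqP (H i)) mxE mulrCA.
Qed.

Lemma generatesB B v v' :
  generates B v -> generates B v' -> generates B (v - v').
Proof.
move=> /forallP H /forallP H'; apply/forallP=> i.
by rewrite span_mapB (eqP (H i)) (eqP (H' i)) !mxE mulrBr.
Qed.

Lemma avoiding_inj v : v \in avoiding row_poly e -> injective (span_map v).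
Proof.
move=> /avoidingP H w w' ww; apply/eqP; rewrite -subr_eq0; apply/eqP/H.
by rewrite span_map_is_additive ww subrr.
Qed.

(** Pigeonhole: an avoiding [v] would inject the $q^n$ matrices [w] into [K]. *)
Lemma avoiding_eq0 : (#|K| < #|F| ^ n)%N -> avoiding row_poly e = set0.
Proof.
move=> ltK; apply/setP=> v; rewrite in_set0; apply/negP => /avoiding_inj/leq_card.
by rewrite card_mx leqNgt ltK.
Qed.

Lemma delay_state_eq0 v : (delay_state v == 0) = (v == 0).
Proof.
apply/eqP/eqP => [|->]; last first.
  by apply/matrixP=> i j; rewrite castmxE !mxE mulr0.
rewrite /delay_state /block_state => H.
have : \mxcol_(k < b.+1) (alpha ^+ k *: v^T) = 0.
  apply: (@castmx_row_inj _ _ _ _ (sum_blocks m b.+1)); rewrite H.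
  by apply/matrixP=> i j; rewrite castmxE !mxE.
move=> /(congr1 (fun M => submxcol M ord0)).
rewrite mxcolK expr0 scale1r => /(congr1 trmx).
by rewrite trmxK => ->; apply/matrixP=> i j; rewrite !mxE.
Qed.

(** * Counting pairs of a companion matrix and an eigenvector *)

Hypothesis m_gt0 : (0 < m)%N.
Hypothesis cardK : #|K| = (#|F| ^ n)%N.
Hypothesis eN0 : forall g : {poly F}, g != 0 -> (size g <= n)%N -> e g != 0.
Variable p : {poly F}.
Hypotheses (p_monic : p \is monic) (size_p : size p = n.+1) (ep : e p = 0).

(** The matrix unit at row [i], column 0 has [v 0 i] as its [span_map]. *)
Lemma avoiding_neq0 v i : v \in avoiding row_poly e -> v 0 i != 0.
Proof.
move=> /avoidingP H; apply/eqP => vi.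
have /H/matrixP/(_ i ord0)/eqP : span_map v (delta_mx i ord0) = 0.
  rewrite /span_map big1 // => k _; have [->|ki] := eqVneq k i; first by rewrite vi mul0r.
  suff -> : row k (delta_mx i ord0 : 'M[F]_(m, b.+1)) = 0.
    by rewrite linear0 rmorph0 mulr0.
  by apply/rowP=> j; rewrite !mxE (negbTE ki).
by rewrite !mxE !eqxx oner_eq0.
Qed.

Lemma generates_char_poly B v :
  v != 0 -> generates B v -> char_poly (transition_mx B) = p.
Proof.
move=> v0 /generatesP Bv; apply: (char_poly_eigenvector eN0 p_monic size_p ep _ Bv).
by rewrite delay_state_eq0.
Qed.

(** [span_map v w = 0] is a linear relation over [F] between the entries of an eigenvector;
    [eigenvector_free] leaves only the trivial one. *)
Lemma generates_avoiding B v :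
  v != 0 -> generates B v -> v \in avoiding row_poly e.
Proof.
move=> v0 Bv; apply/avoidingP => w vw.
have chi0 : e (char_poly (transition_mx B)) = 0 by rewrite (generates_char_poly v0 Bv).
have x0 : delay_state v != 0 by rewrite delay_state_eq0.
have := eigenvector_free eN0 chi0 x0 ((generatesP B v).2 Bv).
move/(_ (castmx (erefl, sum_blocks m b.+1) (\mxrow_k (col k w)^T))).
rewrite mul_delay_state vw raddf0 => /(_ erefl) w0.
have {w0} : \mxrow_k (col k w)^T = 0.
  rewrite -[LHS](castmxK erefl (sum_blocks m b.+1)) w0.
  by apply/matrixP=> i j; rewrite castmxE !mxE.
move=> w0; apply/matrixP=> i j.
move/(congr1 (fun M => submxrow M j)): w0; rewrite mxrowK => /matrixP/(_ 0 i).
by rewrite !mxE.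
Qed.

(** [alpha] is a root of [p], hence an eigenvalue with some eigenvector [delay_state v0]; the set
    counted consists of the nonzero multiples of [v0]. *)
Lemma card_generated B : char_poly (transition_mx B) = p ->
  #|[set v | (v \in avoiding row_poly e) && generates B v]| = #|K|.-1.
Proof.
move=> chiB.
have [v0 v0_neq0 Bv0] : exists2 v, v != 0 & generates B v.
  have : eigenvalue (map_mx iota (transition_mx B))^T alpha.
    rewrite eigenvalue_root_char char_poly_tr -map_char_poly chiB.
    by rewrite /root -evaluationE ep.
  case/eigenvalueP => x xA x0.
  have xA' : map_mx iota (transition_mx B) *m x^T = alpha *: x^T.
    by rewrite -[LHS]trmxK trmx_mul trmxK xA linearZ.
  have [v xv] := eigenvector_delay_state xA'.
  exists v; last by apply/generatesP; rewrite -xv.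
  by rewrite -delay_state_eq0 -xv trmx_eq0.
pose i0 := Ordinal m_gt0.
have v0i : v0 0 i0 != 0 by apply/avoiding_neq0/(generates_avoiding v0_neq0 Bv0).
have -> : [set v | (v \in avoiding row_poly e) && generates B v]
    = (fun c => c *: v0) @: [set~ 0].
  (* An eigenvector with a zero coordinate vanishes. *)
  apply/setP=> v; rewrite inE; apply/andP/imsetP => [[av Bv] | [c]].
    exists (v 0 i0 / v0 0 i0).
      by rewrite !inE mulf_neq0 ?invr_eq0 // avoiding_neq0.
    apply/eqP; rewrite -subr_eq0; apply/negPn/negP => d0.
    have := generates_avoiding d0 (generatesB Bv (generatesZ _ Bv0)).
    by move/(avoiding_neq0 i0)/eqP; case; rewrite !mxE divfK ?subrr.
  rewrite in_setC1 => c0 ->; split; last exact: generatesZ.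
  apply: (generates_avoiding _ (generatesZ c Bv0)).
  by rewrite scaler_eq0 negb_or c0.
rewrite card_imset ?cardsC1 // => c c' /rowP/(_ i0); rewrite !mxE.
exact: (mulIf v0i).
Qed.

(** By cardinality [span_map v] is bijective, so the [i]-th rows of all the blocks are read off the
    unique preimage of [alpha ^+ b.+1 * v 0 i]. *)
Lemma card_generating v :
  v \in avoiding row_poly e -> #|[set B | generates B v]| = 1%N.
Proof.
move=> av; have [f fK Kf] : bijective (span_map v).
  by apply: inj_card_bij; [exact: avoiding_inj | rewrite card_mx cardK].
pose B0 : lfsr F m b.+1 :=
  [ffun j => \matrix_(i, k) f (alpha ^+ b.+1 * v 0 i) k j].
rewrite -(cards1 B0); congr #|pred_of_set _|; apply/setP=> B; rewrite !inE.
apply/forallP/eqP => [H | -> i].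
  apply/ffunP=> j; rewrite ffunE; apply/matrixP=> i k.
  by rewrite mxE -(eqP (H i)) fK mxE.
rewrite (_ : \matrix_(k, j) _ = f (alpha ^+ b.+1 * v 0 i)) ?Kf //.
by apply/matrixP=> k j; rewrite !mxE ffunE mxE.
Qed.

(* Double counting of the pairs [(B, v)] with [generates B v]. *)
Lemma card_avoiding_lfsr :
  #|avoiding row_poly e|
    = (#|[set B : lfsr F m b.+1 | char_poly (transition_mx B) == p]| * #|K|.-1)%N.
Proof.
rewrite -sum1_card -sum_nat_const.
transitivity
  (\sum_(v in avoiding row_poly e) \sum_(B : lfsr F m b.+1) generates B v)%N.
  apply: eq_bigr => v av; rewrite -(card_generating av) -sum1_card big_mkcond /=.
  by apply: eq_bigr => B _; rewrite inE; case: generates.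
rewrite exchange_big /= [RHS]big_mkcond /=; apply: eq_bigr => B _.
rewrite inE; case: eqP => [/card_generated <- | chiB].
  rewrite -sum1_card [LHS]big_mkcond [RHS]big_mkcond /=; apply: eq_bigr => v _.
  by rewrite [in RHS]inE; case: (_ \in _); case: generates.
rewrite big1 // => v av; case: (boolP (generates B v)) => // Bv; case: chiB.
apply: generates_char_poly Bv; apply/eqP => v0.
by have := avoiding_neq0 (Ordinal m_gt0) av; rewrite v0 mxE eqxx.
Qed.

End Companion.

(** * The count *)

Lemma card_avoiding_splitting (F K : finFieldType) (e : {rmorphism {poly F} -> K})
    (m b : nat) (n := (m * b.+1)%N) :
  (0 < m)%N -> #|K| = (#|F| ^ n)%N ->
  (forall g : {poly F}, g != 0 -> (size g <= n)%N -> e g != 0) ->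
  #|avoiding (@row_poly F m b) e|
    = ((#|F| ^ n).-1 * \prod_(1 <= i < m) (#|F| ^ n - #|F| ^ (n - i)))%N.
Proof.
move=> m_gt0 cardK eN0; set q := #|F|.
have q_gt1 : (1 < q)%N by apply: finNzRing_gt1.
have mbn : ((m * b).+1 <= n)%N by rewrite /n mulnS -add1n leq_add2r.
have sg t i : (size (@row_poly F m b t i) <= b.+1)%N by apply: size_poly.
set P := avoiding_poly (@row_poly F m b) e.
have [P_monic sP] : P \is monic /\ size P = m.+1.
  apply: avoiding_poly_monic => t.
  have /matrix0Pn[i [j wij]] := valP t; exists i; apply: eN0.
    apply: contra_neq wij => /(congr1 (fun p : {poly F} => p`_j)).
    by rewrite /row_poly coef_rVpoly_ord mxE coef0.
  by apply: leq_trans (sg t i) _; rewrite /n leq_pmull.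
pose rs : seq rat := 1 :: [seq (q ^ (n - i))%:R | i <- index_iota 1 m].
(* Here $n - m = mb$, so [i < m] keeps the extension degree [n - i] above the degree bound [m * b]
   of the minors. *)
have small i : i \in index_iota 1 m -> (0 < i < n)%N /\ ((m * b).+1 <= n - i)%N.
  rewrite mem_index_iota => /andP[i1 im].
  have : ((m * b).+1 <= n - i)%N.
    by rewrite /n mulnS ltn_subRL ltn_add2r.
  by move=> h; rewrite i1 -subn_gt0 (leq_ltn_trans _ h).
have rootP : all (root P) rs.
  apply/allP=> x; rewrite inE.
  case/orP=> [/eqP->|/mapP[i /small[/andP[i_gt0 i_lt_n] mbi] ->]].
    have w0 : delta_mx (Ordinal m_gt0) ord0 != 0 :> 'M[F]_(m, b.+1).
      by apply/matrix0Pn; exists (Ordinal m_gt0), ord0; rewrite mxE !eqxx oner_eq0.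
    pose t0 : nonzero_mx F m b := exist (fun w => is_true (w != 0)) _ w0.
    exact: (avoiding_poly_root1 (@row_poly F m b) e t0).
  (* [P] is unchanged over the field with $q^{n-i}$ elements, where the avoiding set is empty; hence
     it vanishes at $q^{n-i}$. *)
  have [|K' [e' [cardK' e'N0]]] := @finField_evaluation_exists F (n - i).
    by rewrite subn_gt0.
  rewrite /root /P (avoiding_poly_indep sg (e' := e')).
  - rewrite -/q -cardK' -card_avoiding avoiding_eq0 ?cards0 // cardK' ltn_exp2l //.
    by rewrite ltn_subrL i_gt0 (ltn_trans i_gt0).
  - by move=> g g0 sz; apply: eN0 => //; apply: leq_trans mbn.
  - by move=> g g0 sz; apply: e'N0 => //; apply: leq_trans mbi.
have uniq_rs : uniq rs.
  rewrite cons_uniq; apply/andP; split.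
    apply/negP => /mapP[i /small[_ h]] /eqP; rewrite (@Num.Theory.eqr_nat _ 1 _) eq_sym.
    by rewrite -(expn0 q) eqn_exp2l // -leqn0 leqNgt (leq_ltn_trans _ h).
  rewrite map_inj_in_uniq ?iota_uniq // => i j.
  move=> /small[/andP[_ hi] _] /small[/andP[_ hj] _] /eqP.
  rewrite Num.Theory.eqr_nat eqn_exp2l // => /eqP hij.
  by rewrite -(subKn (ltnW hi)) hij subKn // ltnW.
have szrs : size P = (size rs).+1.
  by rewrite sP /= size_map size_iota subn1 prednK.
have := all_roots_prod_XsubC szrs rootP; rewrite uniq_rootsE => /(_ uniq_rs).
rewrite (monicP P_monic) scale1r => PE.
apply/eqP; rewrite -(Num.Theory.eqr_nat rat) card_avoiding -/P PE cardK -/q horner_prod.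
rewrite big_cons big_map natrM hornerXsubC natr_prod.
apply/eqP; congr (_ * _).
  by rewrite -subn1 natrB // expn_gt0 ltnW.
apply: eq_big_nat => i _.
by rewrite hornerXsubC natrB // leq_exp2l // leq_subr.
Qed.

(** The last block row, present because [b] is positive, lists the feedback matrices. *)
Lemma transition_mx_inj (F : finFieldType) (m b : nat) :
  (0 < b)%N -> injective (@transition_mx F m b).
Proof.
case: b => // b _ B B' /(canRL (castmxK _ _)); rewrite castmx_comp castmx_id.
move/eq_mxblockP => H; apply/ffunP=> j; have := H ord_max j.
by rewrite /transition_block /= eqxx.
Qed.

Theorem theorem4p2 (F : finFieldType) (m b : nat) (hm : (0 < m)%N)
    (hb : (0 < b)%N) (p : {poly F}) (hp : is_primitive_poly (m * b) p) :
  #|[set B : lfsr F m b | char_poly (transition_mx B) == p]|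
    = (\prod_(1 <= i < m) (#|F| ^ (m * b) - #|F| ^ (m * b - i)))%N
  /\
  #|[set A : 'M[F]_(m * b) | is_companion A && (char_poly A == p)]|
    = (\prod_(1 <= i < m) (#|F| ^ (m * b) - #|F| ^ (m * b - i)))%N.
Proof.
suff main : #|[set B : lfsr F m b | char_poly (transition_mx B) == p]|
    = (\prod_(1 <= i < m) (#|F| ^ (m * b) - #|F| ^ (m * b - i)))%N.
  split=> //; rewrite -main -(card_imset _ (@transition_mx_inj F m b hb)).
  apply: eq_card => A; rewrite !inE.
  apply/andP/imsetP => [[/existsP[B /eqP->] chi]|[B]].
    by exists B; rewrite ?inE.
  by rewrite inE => chi ->; split=> //; apply/existsP; exists B.
case: b hb hp => // b _ [L [u [dimL gen_u pu]]].
set n := (m * b.+1)%N in dimL *.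
pose e : {rmorphism {poly F} -> finvect_type L} := horner_alg (FinRing.uval u).
have cardK : #|finvect_type L| = (#|F| ^ n)%N by rewrite card_finvect dimL.
have eN0 (g : {poly F}) : g != 0 -> (size g <= n)%N -> e g != 0.
  by move=> g0 sg; apply: generator_horner_neq0; rewrite ?dimL.
have p_monic : p \is monic by rewrite -(map_monic (in_alg L)) pu monic_minPoly.
have ep : e p = 0.
  by have := root_minPoly 1%AS (FinRing.uval u : L); rewrite /root -pu => /eqP.
have size_p : size p = n.+1.
  (* Lower bound: [e p = 0] contradicts [eN0] for smaller sizes. Upper bound: a minimal polynomial
     over [F] has degree at most [\dim {:L}]. *)
  apply/eqP; rewrite eqn_leq; apply/andP; split; last first.
    rewrite ltnNge; apply: contraL (eN0 p (monic_neq0 p_monic)) _.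
    by rewrite ep eqxx.
  rewrite -(size_map_poly (in_alg L)) pu size_minPoly ltnS.
  by rewrite (adjoin_degree1 (FinRing.uval u : L)) -dimL dimvS // subvf.
(* The two counts of the avoiding vectors agree, and the common factor $q^n - 1$ is positive, so it
   cancels. *)
have := card_avoiding_lfsr hm cardK eN0 p_monic size_p ep.
rewrite (card_avoiding_splitting hm cardK eN0) cardK mulnC => /eqP.
rewrite eqn_pmul2r => [/eqP//|]; rewrite -subn1 subn_gt0 -(exp1n n).
by rewrite ltn_exp2r ?finNzRing_gt1 // muln_gt0 hm.
Qed.
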